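(* Let $(R(t),\omega(t))\in SO(3)\times\mathbb{R}^3$ be a motion of the rigid 3D pendulum, i.e. a solution of $$J\dot\omega = J\omega\times\omega + mg\,\rho\times R^{T}e_3,\qquad \dot R = R\widehat{\omega}.$$ Then the total energy $$E=\tfrac12\,\omega^{T}J\omega - mg\,\rho^{T}R^{T}e_3$$ and the component of the angular momentum vector about the vertical axis through the pivot $$h=\omega^{T}JR^{T}e_3$$ are each constant along the motion.
   Context: The 3D pendulum is a rigid body with a fixed frictionless pivot under uniform gravity. $R\in SO(3)$ is its attitude (mapping body-fixed coordinates to inertial coordinates), $\omega\in\mathbb{R}^3$ its angular velocity in the body-fixed frame, $J\in\mathbb{R}^{3\times 3}$ its constant symmetric positive definite inertia matrix in the body-fixed frame with origin at the pivot, $m>0$ its mass, $g>0$ the gravitational acceleration, $\rho\in\mathbb{R}^3$ the constant body-fixed vector from the pivot to the center of mass, and $e_3=(0,0,1)^T$ the direction of gravity in the inertial frame. It is assumed throughout that $\rho\neq 0$. For $a\in\mathbb{R}^3$, $\widehat a$ is the skew-symmetric $3\times3$ matrix with $\widehat a\,b=a\times b$ for all $b\in\mathbb{R}^3$. $TSO(3)$ is identified with $SO(3)\times\mathbb{R}^3$ via $(R,R\widehat\omega)\leftrightarrow(R,\omega)$. *)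

(* Defs.v *)
From HB Require Import structures.
From mathcomp Require Import all_boot all_order all_algebra.
From mathcomp Require Import all_classical all_reals all_analysis.
From mathcomp Require Import ring.
Import Order.TTheory GRing.Theory Num.Theory.
Import numFieldNormedType.Exports.

Set Implicit Arguments.
Unset Strict Implicit.
Unset Printing Implicit Defensive.

Local Open Scope classical_set_scope.
Local Open Scope ring_scope.

Definition col3 (K : realType) (a b c : K) : 'cV[K]_3 :=
  \col_(i < 3) [:: a; b; c]`_i.

Definition e3 (K : realType) : 'cV[K]_3 := col3 0 0 1.

Definition dotv (K : realType) (u v : 'cV[K]_3) : K := (u^T *m v) 0 0.

(* The numerals 0, 1, 2 index 'I_3, the coordinates being counted from 0. *)
Definition cross (K : realType) (a b : 'cV[K]_3) : 'cV[K]_3 :=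
  col3 (a 1 0 * b 2 0 - a 2 0 * b 1 0)
       (a 2 0 * b 0 0 - a 0 0 * b 2 0)
       (a 0 0 * b 1 0 - a 1 0 * b 0 0).

(* The j-th column of the matrix of [cross a] is the cross product of a with
   the j-th vector of the canonical basis. *)
Definition hat (K : realType) (a : 'cV[K]_3) : 'M[K]_3 :=
  \matrix_(i < 3, j < 3) cross a (delta_mx j 0) i 0.

Lemma hatE (K : realType) (a b : 'cV[K]_3) : hat a *m b = cross a b.
Proof.
apply/matrixP => i j; rewrite (ord1 j) !mxE.
rewrite !big_ord_recl big_ord0 !mxE.
have -> : lift ord0 ord0 = 1 :> 'I_3 by apply/val_inj.
have -> : lift ord0 (lift ord0 ord0) = 2 :> 'I_3 by apply/val_inj.
have -> : ord0 = 0 :> 'I_3 by [].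
by case: i => [[|[|[|//]]] ?] /=; ring.
Qed.

Lemma hat_skew (K : realType) (a : 'cV[K]_3) : (hat a)^T = - hat a.
Proof.
apply/matrixP => i j; rewrite !mxE.
by case: i => [[|[|[|//]]] ?]; case: j => [[|[|[|//]]] ?] /=; ring.
Qed.

Definition SO3 (K : realType) : set 'M[K]_3 :=
  [set Q | Q^T *m Q = 1%:M /\ \det Q = 1].

Definition sym_posdef (K : realType) (J : 'M[K]_3) : Prop :=
  J^T = J /\ forall x : 'cV[K]_3, x != 0 -> 0 < dotv x (J *m x).

(* The interval I may be open, closed or half-open, bounded or not. The
   equations are imposed at the interior times; continuity on I makes the
   endpoints belonging to I part of the motion. On an open I the two continuity
   conditions are redundant. *)
Definition pendulum_motion (K : realType) (J : 'M[K]_3) (m g : K)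
    (rho : 'cV[K]_3) (I : set K) (R : K -> 'M[K]_3) (omega : K -> 'cV[K]_3) :=
  [/\ forall t, I t -> SO3 (R t),
      {within I, continuous R},
      {within I, continuous omega} &
      forall t, interior I t ->
        [/\ derivable R t 1,
            derivable omega t 1,
            J *m derive1 omega t =
              cross (J *m omega t) (omega t)
              + (m * g) *: cross rho ((R t)^T *m e3 K) &
            derive1 R t = R t *m hat (omega t)]].

Definition energy (K : realType) (J : 'M[K]_3) (m g : K) (rho : 'cV[K]_3)
    (Q : 'M[K]_3) (w : 'cV[K]_3) : K :=
  2^-1 * dotv w (J *m w) - m * g * dotv rho (Q^T *m e3 K).

Definition vertical_momentum (K : realType) (J : 'M[K]_3)
    (Q : 'M[K]_3) (w : 'cV[K]_3) : K :=
  dotv w (J *m (Q^T *m e3 K)).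

(* Main.v *)
(* Since R' = R hat(omega) and hat(omega) is skew-symmetric, the vertical seen
   from the body, x = R^T e3, satisfies x' = x * omega (cross product). By the
   symmetry of J and the alternation of the scalar triple product, the
   derivatives of the energy and of the vertical momentum vanish at interior
   times. The mean value theorem, which needs only continuity at the endpoints,
   gives constancy on the whole interval. *)
Require Import Defs.
From mathcomp Require Import all_boot all_order all_algebra.
From mathcomp Require Import all_classical all_reals all_analysis.
From mathcomp Require Import ring.
Import Order.TTheory GRing.Theory Num.Theory.
Import numFieldNormedType.Exports.
Set Implicit Arguments.
Unset Strict Implicit.
Unset Printing Implicit Defensive.
Local Open Scope classical_set_scope.
Local Open Scope ring_scope.

(** Between [s] and [t] the mean value theorem applies: the segment lies in [I] by convexity, so [f]
    is continuous on it, and its open part consists of interior points of [I] even when [s] or [t]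
    is an endpoint of [I]. *)
Lemma is_interval_constant (K : realType) (I : set K) (f : K -> K) :
  is_interval I -> {within I, continuous f} ->
  (forall t, interior I t -> is_derive t 1 f 0) ->
  forall s t, I s -> I t -> f s = f t.
Proof.
move=> Iitv fcont df s t.
wlog lt_st : s t / s < t.
  move=> H Is It; have [st|ts|->//] := ltgtP s t; first exact: H.
  by apply/esym; exact: H.
move=> Is It.
have stI : `[s, t]%classic `<=` I.
  by move=> z /=; rewrite in_itv /= => zst; exact: (Iitv s t).
have [||c _] := MVT (f := f) (df := fun=> 0) lt_st.
- move=> z zst; apply: df.
  (* The open interval from [s] to [t] is a neighbourhood of [z] contained in [I]. *)
  apply: (filterS (fun y yst => stI y (subset_itv_oo_cc yst))).
  exact: near_in_itvoo.
- exact: continuous_subspaceW fcont.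
- by rewrite mul0r => /eqP; rewrite subr_eq0 => /eqP.
Qed.

(** The domain is an arbitrary topological space so that [T] can be [subspace I], where continuity
    means continuity within [I]. *)
Lemma mulmx_entry_continuous (K : realType) (T : topologicalType) (m n p : nat)
    (A : T -> 'M[K]_(m, n)) (B : T -> 'M[K]_(n, p)) :
  (forall i j, continuous (fun t => A t i j)) ->
  (forall i j, continuous (fun t => B t i j)) ->
  forall i j, continuous (fun t => (A t *m B t) i j).
Proof.
move=> Acont Bcont i j.
under eq_fun do rewrite mxE.
apply: continuous_big => [|k _ s]; first exact: add_continuous.
by apply: cvgM; [exact: Acont|exact: Bcont].
Qed.

(** Leibniz rule for matrices, taken entry by entry so that it reduces to the scalar rule for sums
    and products. *)
Lemma is_derive_mulmx_entry (K : realType) (m n p : nat) (t : K)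
    (A : K -> 'M[K]_(m, n)) (B : K -> 'M[K]_(n, p))
    (A' : 'M[K]_(m, n)) (B' : 'M[K]_(n, p)) :
  (forall i j, is_derive t 1 (fun s => A s i j) (A' i j)) ->
  (forall i j, is_derive t 1 (fun s => B s i j) (B' i j)) ->
  forall i j,
    is_derive t 1 (fun s => (A s *m B s) i j) ((A' *m B t + A t *m B') i j).
Proof.
move=> dA dB i j.
(* As a sum of products in the ring of functions, the entry has a derivative found by instance
   resolution; only the equality of the derivatives remains. *)
have -> : (fun s => (A s *m B s) i j) =
    \sum_(k < n) ((fun s => A s i k) * (fun s => B s k j)).
  by apply/funext => s; rewrite mxE fct_sumE.
apply: is_derive_eq.
rewrite !mxE -big_split /=; apply: eq_bigr => k _.
by rewrite /GRing.scale /=; ring.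
Qed.

Lemma is_derive_mx_entry (K : realType) (m n : nat) (t : K)
    (A : K -> 'M[K]_(m, n)) :
  derivable A t 1 ->
  forall i j, is_derive t 1 (fun s => A s i j) (derive1 A t i j).
Proof.
move=> dA i j; rewrite derive1E derive_mx// mxE.
by apply: derivableP; move/derivable_mxP: dA; apply.
Qed.

Lemma dotvC (K : realType) (u v : 'cV[K]_3) : dotv u v = dotv v u.
Proof. by rewrite /dotv -[u^T *m v]trmxK trmx_mul trmxK mxE. Qed.

Lemma dotvDr (K : realType) (u v w : 'cV[K]_3) :
  dotv u (v + w) = dotv u v + dotv u w.
Proof. by rewrite /dotv mulmxDr mxE. Qed.

Lemma dot0v (K : realType) (u : 'cV[K]_3) : dotv 0 u = 0.
Proof. by rewrite /dotv trmx0 mul0mx mxE. Qed.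

Lemma dotvNr (K : realType) (u v : 'cV[K]_3) : dotv u (- v) = - dotv u v.
Proof. by rewrite /dotv mulmxN mxE. Qed.

Lemma dotvZr (K : realType) (a : K) (u v : 'cV[K]_3) :
  dotv u (a *: v) = a * dotv u v.
Proof. by rewrite /dotv -scalemxAr mxE. Qed.

Lemma dotv_mulmx_sym (K : realType) (J : 'M[K]_3) (u v : 'cV[K]_3) :
  J^T = J -> dotv u (J *m v) = dotv v (J *m u).
Proof.
by move=> J_sym; rewrite (dotvC v) /dotv trmx_mul J_sym mulmxA.
Qed.

Lemma dotvE (K : realType) (u v : 'cV[K]_3) :
  dotv u v = u 0 0 * v 0 0 + u 1 0 * v 1 0 + u 2 0 * v 2 0.
Proof.
rewrite /dotv !mxE !big_ord_recl big_ord0 !mxE addr0 addrA.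
have -> : lift ord0 ord0 = 1 :> 'I_3 by apply/val_inj.
by have -> : lift ord0 (lift ord0 ord0) = 2 :> 'I_3 by apply/val_inj.
Qed.

(** Cyclic invariance of the scalar triple product. *)
Lemma dotv_crossC (K : realType) (u v w : 'cV[K]_3) :
  dotv u (cross v w) = dotv w (cross u v).
Proof. by rewrite !dotvE !mxE /=; ring. Qed.

Lemma crossC (K : realType) (u v : 'cV[K]_3) : cross u v = - cross v u.
Proof.
apply/matrixP => i j; rewrite !mxE.
by case: i => [[|[|[|//]]] ?] /=; ring.
Qed.

Lemma dotv_crossl (K : realType) (u v : 'cV[K]_3) : dotv u (cross u v) = 0.
Proof. by rewrite !dotvE !mxE /=; ring. Qed.

Lemma dotv_continuous (K : realType) (T : topologicalType)
    (u v : T -> 'cV[K]_3) :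
  (forall i j, continuous (fun t => u t i j)) ->
  (forall i j, continuous (fun t => v t i j)) ->
  continuous (fun t => dotv (u t) (v t)).
Proof.
move=> ucont vcont; apply: mulmx_entry_continuous => // i j.
by under eq_fun do rewrite mxE; exact: ucont.
Qed.

Lemma is_derive_dotv (K : realType) (t : K) (u v : K -> 'cV[K]_3)
    (u' v' : 'cV[K]_3) :
  (forall i j, is_derive t 1 (fun s => u s i j) (u' i j)) ->
  (forall i j, is_derive t 1 (fun s => v s i j) (v' i j)) ->
  is_derive t 1 (fun s => dotv (u s) (v s)) (dotv u' (v t) + dotv (u t) v').
Proof.
move=> du dv.
have du_tr i j : is_derive t 1 (fun s => (u s)^T i j) (u'^T i j).
  by rewrite mxE; under eq_fun do rewrite mxE; exact: du.
by have := is_derive_mulmx_entry du_tr dv 0 0; rewrite mxE.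
Qed.

(** Puts a constant matrix in the form expected by the product rules, with the zero matrix as
    derivative. *)
Lemma is_derive_cst_entry (K : realType) (m n : nat) (t : K)
    (A : 'M[K]_(m, n)) i j :
  is_derive t 1 (fun=> A i j) ((0 : 'M[K]_(m, n)) i j).
Proof. by rewrite [X in is_derive _ _ _ X]mxE; exact: is_derive_cst. Qed.

Lemma is_derive_mulmxl_entry (K : realType) (m n p : nat) (t : K)
    (A : 'M[K]_(m, n)) (B : K -> 'M[K]_(n, p)) (B' : 'M[K]_(n, p)) :
  (forall i j, is_derive t 1 (fun s => B s i j) (B' i j)) ->
  forall i j, is_derive t 1 (fun s => (A *m B s) i j) ((A *m B') i j).
Proof.
move=> dB i j.
have := is_derive_mulmx_entry (is_derive_cst_entry t A) dB i j.
by rewrite mul0mx add0r.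
Qed.

Lemma motion_omega_entry_continuous (K : realType) (J : 'M[K]_3) (m g : K)
    (rho : 'cV[K]_3) (I : set K) (R : K -> 'M[K]_3) (omega : K -> 'cV[K]_3) :
  pendulum_motion J m g rho I R omega ->
  forall i j, {within I, continuous (fun t => omega t i j)}.
Proof.
move=> [_ _ omega_cont _] i j t.
exact: (continuous_comp (omega_cont t) (@coord_continuous _ _ _ _ _ _)).
Qed.

Lemma motion_vertical_entry_continuous (K : realType) (J : 'M[K]_3) (m g : K)
    (rho : 'cV[K]_3) (I : set K) (R : K -> 'M[K]_3) (omega : K -> 'cV[K]_3) :
  pendulum_motion J m g rho I R omega ->
  forall i j, {within I, continuous (fun t => ((R t)^T *m e3 K) i j)}.
Proof.
move=> [_ R_cont _ _].
apply: (@mulmx_entry_continuous _ (subspace I)) => k l t; last exact: cvg_cst.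
under eq_fun do rewrite mxE.
exact: (continuous_comp (R_cont t) (@coord_continuous _ _ _ _ _ _)).
Qed.

Lemma is_derive_motion_omega_entry (K : realType) (J : 'M[K]_3) (m g : K)
    (rho : 'cV[K]_3) (I : set K) (R : K -> 'M[K]_3) (omega : K -> 'cV[K]_3) (t : K) :
  pendulum_motion J m g rho I R omega -> interior I t ->
  forall i j, is_derive t 1 (fun s => omega s i j) (derive1 omega t i j).
Proof.
by move=> [_ _ _ /[apply] -[_ domega _ _]]; exact: is_derive_mx_entry.
Qed.

Lemma is_derive_motion_vertical_entry (K : realType) (J : 'M[K]_3) (m g : K)
    (rho : 'cV[K]_3) (I : set K) (R : K -> 'M[K]_3) (omega : K -> 'cV[K]_3) (t : K) :
  pendulum_motion J m g rho I R omega -> interior I t ->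
  forall i j, is_derive t 1 (fun s => ((R s)^T *m e3 K) i j)
    (cross ((R t)^T *m e3 K) (omega t) i j).
Proof.
move=> [_ _ _ /[apply] -[dR _ _ R_eq]] i j.
have dRT k l : is_derive t 1 (fun s => (R s)^T k l) ((derive1 R t)^T k l).
  by rewrite mxE; under eq_fun do rewrite mxE; exact: is_derive_mx_entry.
have := is_derive_mulmx_entry dRT (is_derive_cst_entry t (e3 K)) i j.
(* With [x] the vertical in the body frame, the transpose of [R *m hat omega] applied to [e3] is
   [(hat omega)^T *m x], that is [- cross omega x]. *)
by rewrite mulmx0 addr0 R_eq trmx_mul -mulmxA hat_skew mulNmx hatE -crossC.
Qed.

Lemma is_derive_energy (K : realType) (J : 'M[K]_3) (m g : K)
    (rho : 'cV[K]_3) (I : set K) (R : K -> 'M[K]_3) (omega : K -> 'cV[K]_3) (t : K) :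
  J^T = J -> pendulum_motion J m g rho I R omega -> interior I t ->
  is_derive t 1 (fun s => energy J m g rho (R s) (omega s)) 0.
Proof.
move=> J_sym motion It.
have domega := is_derive_motion_omega_entry motion It.
have dkin := is_derive_dotv domega (is_derive_mulmxl_entry J domega).
have dpot := is_derive_dotv (is_derive_cst_entry t rho)
  (is_derive_motion_vertical_entry motion It).
apply: (@is_derive_eq _ _ _ (2^-1 \*: (fun s => dotv (omega s) (J *m omega s))
  - (m * g) \*: (fun s => dotv rho ((R s)^T *m e3 K)))).
have [_ _ _ /(_ t It) [_ _ omega_eq _]] := motion.
(* By the symmetry of [J], both terms of the kinetic derivative equal [dotv omega (J *m omega')],
   where the equation of motion can be substituted. *)
rewrite /GRing.scale /= (dotv_mulmx_sym (derive1 omega t)) //.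
rewrite omega_eq dotvDr dotvZr dot0v add0r.
(* The gyroscopic term does no work, since it is orthogonal to [omega]. The power of the gravity
   torque, [dotv omega (cross rho x)], is rotated cyclically into [dotv rho (cross x omega)], which
   the potential term cancels. *)
rewrite (dotv_crossC _ (J *m _)) dotv_crossl (dotv_crossC (omega t)) dotv_crossC.
by field.
Qed.

Lemma is_derive_vertical_momentum (K : realType) (J : 'M[K]_3) (m g : K)
    (rho : 'cV[K]_3) (I : set K) (R : K -> 'M[K]_3) (omega : K -> 'cV[K]_3) (t : K) :
  J^T = J -> pendulum_motion J m g rho I R omega -> interior I t ->
  is_derive t 1 (fun s => vertical_momentum J (R s) (omega s)) 0.
Proof.
move=> J_sym motion It.
have domega := is_derive_motion_omega_entry motion It.
have dx := is_derive_motion_vertical_entry motion It.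
apply: (is_derive_eq (is_derive_dotv domega (is_derive_mulmxl_entry J dx))).
have [_ _ _ /(_ t It) [_ _ omega_eq _]] := motion.
(* Symmetry moves [J] off the vertical [x], so that the derivative becomes [dotv x (J *m omega') +
   dotv (cross x omega) (J *m omega)]. *)
rewrite (dotv_mulmx_sym (derive1 omega t))// (dotv_mulmx_sym (omega t))//.
(* The gravity torque [cross rho x] is orthogonal to [x], hence has no vertical component. *)
rewrite omega_eq dotvDr dotvZr (dotv_crossC _ rho) dotv_crossl mulr0 addr0.
(* The two remaining triple products involve [x], [omega] and [J *m omega] in opposite orientations,
   so they cancel. *)
rewrite [X in _ + X]dotvC dotv_crossC (dotv_crossC (omega t)).
by rewrite (crossC (omega t)) dotvNr addNr.
Qed.

Theorem proposition1 (K : realType) (J : 'M[K]_3) (m g : K) (rho : 'cV[K]_3)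
    (I : set K) (R : K -> 'M[K]_3) (omega : K -> 'cV[K]_3)
    (J_spd : sym_posdef J) (m_gt0 : 0 < m) (g_gt0 : 0 < g) (rho_neq0 : rho != 0)
    (I_itv : is_interval I) (motion : pendulum_motion J m g rho I R omega) :
  (forall s t : K, I s -> I t ->
     energy J m g rho (R s) (omega s) = energy J m g rho (R t) (omega t)) /\
  (forall s t : K, I s -> I t ->
     vertical_momentum J (R s) (omega s) = vertical_momentum J (R t) (omega t)).
Proof.
have [J_sym _] := J_spd.
have omega_cont := motion_omega_entry_continuous motion.
have x_cont := motion_vertical_entry_continuous motion.
split.
- apply: (is_interval_constant
    (f := fun t => energy J m g rho (R t) (omega t)) I_itv) => [t|t It].
    (* Once the constant factors are discharged, the kinetic and potential dot products remain, each
       continuous on [subspace I]. *)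
    apply: cvgB; apply: cvgM; try exact: cvg_cst.
      apply: (dotv_continuous (T := subspace I)) => //.
      by apply: mulmx_entry_continuous => // i j ?; exact: cvg_cst.
    by apply: (dotv_continuous (T := subspace I)) => // i j ?; exact: cvg_cst.
  exact: is_derive_energy J_sym motion It.
- apply: (is_interval_constant
    (f := fun t => vertical_momentum J (R t) (omega t)) I_itv) => [|t It].
    apply: (dotv_continuous (T := subspace I)) => //.
    by apply: mulmx_entry_continuous => // i j ?; exact: cvg_cst.
  exact: is_derive_vertical_momentum J_sym motion It.
Qed.
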